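(* For all $m\ge 1$ and $n\ge 0$, the assignments $t\mapsto t$ (for unrooted trees $t$ of order $2n$) and $J^{\infty}\mapsto 1\otimes J$ (for rooted trees $J$ of order $n$; unrooted trees in $\mathcal T^{\infty}_{2n}(m)$ being sent to $0$) give well-defined homomorphisms fitting into an exact sequence of abelian groups \[ 0 \longrightarrow \mathcal T_{2n}(m) \longrightarrow \mathcal T^{\infty}_{2n}(m) \longrightarrow \mathbb Z_2 \otimes \mathcal L_{n}(m) \longrightarrow 0 . \]
   Context: Trees. A tree is a finite unitrivalent tree (all vertices have valence 1 or 3) with at least one edge, equipped with a vertex orientation (a cyclic ordering of the three edges at each trivalent vertex). A tree is rooted if exactly one univalent vertex, the root, is unlabeled and all other univalent vertices are labeled by elements of $\{1,\dots,m\}$; it is unrooted if all univalent vertices are labeled by elements of $\{1,\dots,m\}$ (labels may repeat). Trees are considered up to isomorphism preserving labels, root and vertex orientations. The order of a tree is its number of trivalent vertices. Products. For rooted trees $I,J$, the rooted product $(I,J)$ is the rooted tree obtained by identifying the two roots to one vertex and attaching a new rooted edge there, with cyclic order ($I$-edge, $J$-edge, root edge) at the new trivalent vertex. The inner product $\langle I,J\rangle$ is the unrooted tree obtained by gluing the two rooted edges of $I$ and $J$ into a single edge; its order is the sum of the orders of $I$ and $J$. Groups. $\mathcal L_n(m)$ is the abelian group generated by rooted trees of order $n$, modulo the AS and IHX relations; $\mathcal T_n(m)$ is the abelian group generated by unrooted trees of order $n$, modulo the AS and IHX relations. AS: $J+\bar J=0$, where $\bar J$ (also written $-J$) is obtained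 from the tree $J$ by reversing the cyclic ordering at one trivalent vertex. IHX: $I-H+X=0$, where $I,H,X$ are three trees that agree outside one place, where they contain respectively the subtrees $((A,B),C)$, $(A,(B,C))$, $((C,A),B)$ for some rooted trees $A,B,C$. (For unrooted trees: $\langle((A,B),C),D\rangle-\langle(A,(B,C)),D\rangle+\langle((C,A),B),D\rangle=0$ for rooted trees $A,B,C,D$.) Such a triple $(I,H,X)$ is called an IHX triple. Twisted group. $\mathcal T^{\infty}_{2n}(m)$ is the abelian group obtained from $\mathcal T_{2n}(m)$ by adding one new generator $J^{\infty}$ for each rooted tree $J$ of order $n$, and the following relations, for all rooted trees $J$ of order $n$ and all IHX triples $(I,H,X)$ of rooted trees of order $n$: \[ J^{\infty}=(-J)^{\infty},\qquad 2\cdot J^{\infty}=\langle J,J\rangle,\qquad I^{\infty}=H^{\infty}+X^{\infty}-\langle H,X\rangle . \] *)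

(* Defs.v *)
From HB Require Import structures.
From mathcomp Require Import all_boot all_order all_algebra.
From mathcomp Require Import zify boolp.
From mathcomp.multinomials Require Import freeg.

Set Implicit Arguments.
Unset Strict Implicit.
Unset Printing Implicit Defensive.

Import GRing.Theory.
Local Open Scope ring_scope.

(* The quotient of V by the subgroup generated by R; membership in that subgroup
   is made boolean classically.                                               *)
Section Quotient.
Variables (V : zmodType) (R : V -> Prop).

Inductive generated : V -> Prop :=
| generated_rel x : R x -> generated x
| generated0 : generated 0
| generatedB x y : generated x -> generated y -> generated (x - y).

Definition gen_sub : {pred V} := fun x => `[< generated x >].

Lemma gen_subP x : reflect (generated x) (x \in gen_sub).
Proof. exact: asboolP. Qed.

Fact gen_sub_zmod_closed : zmod_closed gen_sub.
Proof.
split=> [|x y /gen_subP gx /gen_subP gy]; apply/gen_subP; first exact: generated0.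
exact: generatedB.
Qed.

HB.instance Definition _ := GRing.isZmodClosed.Build V gen_sub gen_sub_zmod_closed.

Definition quotg : zmodType := Quotient.quot gen_sub.

Definition quotg_pi (x : V) : quotg := \pi_(Quotient.quot gen_sub)%qT x.

End Quotient.
Arguments quotg_pi {V} R x.

Definition short_exact (A B C : zmodType) (f : A -> B) (g : B -> C) : Prop :=
  [/\ injective f, forall b, g b = 0 <-> exists a, f a = b
    & forall c, exists b, g b = c].

Section Tensor.
Variables A B : zmodType.

(* The tensor product over the integers. *)
Inductive tensor_rel : {freeg (A * B)%type} -> Prop :=
| tensor_relDl a a' b : tensor_rel (<< (a + a', b) >> - << (a, b) >> - << (a', b) >>)
| tensor_relDr a b b' : tensor_rel (<< (a, b + b') >> - << (a, b) >> - << (a, b') >>).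

Definition tensor : zmodType := quotg tensor_rel.
Definition tens (a : A) (b : B) : tensor := quotg_pi tensor_rel << (a, b) >>.

End Tensor.

(* A graph is presented by its half-edges: [opp d] is the other half of the edge
   of d, and [nxt d] the successor of d in the cyclic order at its vertex, so
   that edges are the orbits of [opp] and vertices the orbits of [nxt].        *)
Record graph (m : nat) (D : finType) := Graph {
  opp : D -> D;
  nxt : D -> D;
  lab : D -> option 'I_m }.

Section Graphs.
Variables (m : nat) (D : finType) (g : graph m D).

Definition univalent : pred D := [pred d | nxt g d == d].
Definition adj : rel D := [rel x y | (y == opp g x) || (y == nxt g x)].

Definition nverts : nat := fcard (nxt g) D.
Definition nedges : nat := fcard (opp g) D.
Definition tree_order : nat := fcard (nxt g) [predC univalent].

(* Finite trees are the connected finite graphs of Euler characteristic 1 (in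
   particular there is at least one edge, since an isolated vertex carries no
   half-edge).  Trivalent vertices carry no label.                            *)
Record is_tree : Prop := IsTree {
  oppK : involutive (opp g);
  opp_neq : forall d, opp g d != d;
  nxt3 : forall d, nxt g (nxt g (nxt g d)) = d; (* valence 1 or 3 *)
  adj_connected : forall x y, connect adj x y;
  euler : nverts = nedges.+1;
  lab_trivalent : forall d, ~~ univalent d -> lab g d = None }.

Definition is_rooted (r : D) : Prop :=
  is_tree /\ forall d, univalent d && (lab g d == None) = (d == r).

Definition is_unrooted : Prop :=
  is_tree /\ forall d, univalent d -> lab g d != None.

Definition reverse_at (v : D) : graph m D :=
  Graph (opp g)
    (fun d => if fconnect (nxt g) v d then finv (nxt g) d else nxt g d)
    (lab g).

End Graphs.

(* The root is the only unlabeled univalent vertex, hence is preserved too. *)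
Definition iso (m : nat) (D D' : finType) (g : graph m D) (g' : graph m D') : Prop :=
  exists f : D -> D',
    [/\ bijective f, {morph f : d / opp g d >-> opp g' d},
        {morph f : d / nxt g d >-> nxt g' d} & forall d, lab g' (f d) = lab g d].

Record rtree (m : nat) := RTree {
  rdart : finType;
  rgraph :> graph m rdart;
  root : rdart;
  rtreeP : is_rooted rgraph root }.

Record utree (m : nat) := UTree {
  udart : finType;
  ugraph :> graph m udart;
  utreeP : is_unrooted ugraph }.

Section Count.
Variables (m : nat) (D : finType) (g : graph m D).
Hypotheses (oK : involutive (opp g)) (oN : forall d, opp g d != d).
Hypothesis n3 : forall d, nxt g (nxt g (nxt g d)) = d.

Lemma nxt_inj : injective (nxt g).
Proof. by move=> x y /(congr1 (fun z => nxt g (nxt g z))); rewrite !n3. Qed.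

Lemma nedgesE : (nedges g * 2 = #|D|)%N.
Proof.
rewrite /nedges; apply: (fcard_order_set (inv_inj oK)) => [|//].
apply/subsetP=> x _; rewrite inE.
have: fcycle (opp g) [:: x; opp g x] by rewrite /= !eqxx oK eqxx.
move/order_cycle => -> //=; first by rewrite inE andbT eq_sym oN.
by rewrite inE eqxx.
Qed.

Lemma orderE : (tree_order g * 3 = #|[predC univalent g]|)%N.
Proof.
apply: fcard_order_set; first exact: nxt_inj.
  apply/subsetP=> x; rewrite !inE => xN.
  have: fcycle (nxt g) [:: x; nxt g x; nxt g (nxt g x)].
    by rewrite /= !eqxx n3 eqxx.
  move/order_cycle => -> //=; last by rewrite !inE eqxx.
  rewrite !inE negb_or (inj_eq nxt_inj) (eq_sym x (nxt g x)) xN !andbT /=.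
  by apply: contra xN => /eqP e; rewrite {1}e n3.
by move=> x y /eqP <-; rewrite !inE (inj_eq nxt_inj).
Qed.

Lemma nvertsE : (nverts g = #|univalent g| + tree_order g)%N.
Proof.
rewrite /nverts (n_compC [predC univalent g]) addnC; congr (_ + _)%N.
rewrite -[RHS](fcard_order_set nxt_inj (n := 1%N)) ?muln1 //.
- by apply: eq_n_comp_r => x; rewrite !inE negbK.
- apply/subsetP=> x; rewrite !inE => /eqP xN.
  have: fcycle (nxt g) [:: x] by rewrite /= xN eqxx.
  by move/order_cycle => -> //=; rewrite ?inE ?eqxx.
- by move=> x y /eqP <-; rewrite !inE (inj_eq nxt_inj).
Qed.

Lemma eulerE : nverts g = (nedges g).+1 <->
  (#|[predC univalent g]| + 6 = #|univalent g| * 3)%N.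
Proof.
have := nedgesE; have := orderE; have := nvertsE; have := cardC (univalent g).
rewrite /=; lia.
Qed.

Lemma connect_adj_sym : symmetric (connect (adj g)).
Proof.
suff step x y : adj g x y -> connect (adj g) y x.
  suff sub x y : connect (adj g) x y -> connect (adj g) y x by move=> x y; apply/idP/idP; apply: sub.
  case/connectP=> p; elim: p x => [|z p IH] x /= => [_ ->//|/andP[/step xz zp] e].
  exact: connect_trans (IH z zp e) xz.
case/orP=> /eqP ->; first by apply: connect1; rewrite /adj /= oK eqxx.
apply: (@connect_trans _ _ (nxt g (nxt g x))); apply: connect1.
  by rewrite /adj /= eqxx orbT.
by rewrite /adj /= n3 eqxx orbT.
Qed.

End Count.

Section RTreeTheory.
Variables (m : nat) (I : rtree m).

Lemma rtree_tree : is_tree I. Proof. by case: (rtreeP I). Qed.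

Lemma root_univalent : nxt I (root I) = root I.
Proof. by case: (rtreeP I) => _ /(_ (root I)); rewrite eqxx => /andP[/eqP]. Qed.

Lemma root_lab : lab I (root I) = None.
Proof. by case: (rtreeP I) => _ /(_ (root I)); rewrite eqxx => /andP[_ /eqP]. Qed.

Lemma nxt_root d : (nxt I d == root I) = (d == root I).
Proof. by rewrite -{1}root_univalent (inj_eq (nxt_inj (nxt3 rtree_tree))). Qed.

Lemma rtree_lab d : univalent I d -> d != root I -> lab I d != None.
Proof. by case: (rtreeP I) => _ /(_ d) <- ->. Qed.

Lemma card_univalent :
  #|univalent I| = #|[pred d | univalent I d && (d != root I)]|.+1.
Proof.
rewrite (cardD1 (root I)) inE /= root_univalent eqxx add1n; congr _.+1.
by apply: eq_card => d; rewrite !inE andbC.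
Qed.

Lemma rtree_euler : (#|[predC univalent I]| + 6 = #|univalent I| * 3)%N.
Proof.
have [oK oN n3 _ /eulerE e _] := rtree_tree; exact: e.
Qed.

End RTreeTheory.

Section Product.
Variables (m : nat) (I J : rtree m).

(* [inr false] and [inr true] are the halves of the new root edge, at the new
   trivalent vertex and at the new root respectively.                         *)
Definition prod_dart : finType := (rdart I + rdart J + bool)%type.

Definition prod_opp (d : prod_dart) : prod_dart :=
  match d with
  | inl (inl x) => inl (inl (opp I x))
  | inl (inr y) => inl (inr (opp J y))
  | inr b => inr (~~ b)
  end.

Definition prod_nxt (d : prod_dart) : prod_dart :=
  match d with
  | inl (inl x) => if x == root I then inl (inr (root J)) else inl (inl (nxt I x))
  | inl (inr y) => if y == root J then inr false else inl (inr (nxt J y))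
  | inr false => inl (inl (root I))
  | inr true => inr true
  end.

Definition prod_lab (d : prod_dart) : option 'I_m :=
  match d with
  | inl (inl x) => lab I x
  | inl (inr y) => lab J y
  | inr _ => None
  end.

Definition prod_graph : graph m prod_dart := Graph prod_opp prod_nxt prod_lab.

Lemma prod_univalent d : univalent prod_graph d =
  match d with
  | inl (inl x) => univalent I x && (x != root I)
  | inl (inr y) => univalent J y && (y != root J)
  | inr b => b
  end.
Proof.
case: d => [[x|y]|[]]; rewrite /univalent /= ?eqxx //; [case: (eqVneq x (root I))|case: (eqVneq y (root J))] => _ /=; by rewrite ?andbF ?andbT.
Qed.

Lemma card_prod_univalent :
  (#|univalent prod_graph| = #|univalent I|.-1 + #|univalent J|.-1 + 1)%N.
Proof.
rewrite !card_univalent /= -!sum1_card big_sumType /= big_sumType /=.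
congr (_ + _ + _)%N; first by apply: eq_bigl => x; exact: prod_univalent (inl (inl x)).
  by apply: eq_bigl => x; exact: prod_univalent (inl (inr x)).
rewrite (big_pred1 true) // => b; rewrite [in RHS]inE; etransitivity; [exact: (prod_univalent (inr b))|by case: b].
Qed.

Lemma prod_is_tree : is_tree prod_graph.
Proof.
have [oKI oNI n3I cI _ lI] := rtree_tree I; have [oKJ oNJ n3J cJ _ lJ] := rtree_tree J.
have oK : involutive (opp prod_graph).
  by case=> [[x|y]|b] /=; rewrite ?oKI ?oKJ ?negbK.
have oN d : opp prod_graph d != d.
  by case: d => [[x|y]|[]] //=; [exact: oNI | exact: oNJ].
have n3 d : nxt prod_graph (nxt prod_graph (nxt prod_graph d)) = d.
  case: d => [[x|y]|[]] /=; rewrite ?eqxx //=; last by rewrite eqxx.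
    case: eqVneq => [->|xN] /=; rewrite ?eqxx //=.
    by rewrite !(nxt_root, negPf xN) /= !(nxt_root, negPf xN) n3I.
  case: eqVneq => [->|yN] /=; rewrite ?eqxx //=.
  by rewrite !(nxt_root, negPf yN) /= !(nxt_root, negPf yN) n3J.
have sym := connect_adj_sym oK n3.
pose r : prod_dart := inr true.
have stp x y : adj prod_graph x y -> connect (adj prod_graph) x y by exact: connect1.
have c0 : connect (adj prod_graph) r (inr false) by apply: stp; rewrite /adj /= ?eqxx.
have cI0 : connect (adj prod_graph) r (inl (inl (root I))).
  by apply: (connect_trans c0); apply: stp; rewrite /adj /= ?eqxx ?orbT.
have cJ0 : connect (adj prod_graph) r (inl (inr (root J))).
  by apply: (connect_trans cI0); apply: stp; rewrite /adj /= ?eqxx ?orbT.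
have ind_path (T : finType) (e : rel T) (P : T -> Prop) x :
    (forall y z, P y -> e y z -> P z) -> P x -> forall y, connect e x y -> P y.
  move=> st Px y /connectP[p]; elim: p x Px => [|z p IH] x Px /= => [_ ->//|/andP[xz zp]].
  exact: (IH z (st _ _ Px xz) zp).
have cr d : connect (adj prod_graph) r d.
  case: d => [[x|y]|[|]] //.
  - apply: (ind_path _ _ (fun x => connect (adj prod_graph) r (inl (inl x))) _ _ cI0 x (cI _ _)).
    move=> y z cy /orP[]/eqP->; first by apply: (connect_trans cy); apply: stp; rewrite /adj /= ?eqxx.
    case: (eqVneq y (root I)) => [->|yN]; first by rewrite root_univalent.
    by apply: (connect_trans cy); apply: stp; rewrite /adj /= (negPf yN) eqxx orbT.
  - apply: (ind_path _ _ (fun x => connect (adj prod_graph) r (inl (inr x))) _ _ cJ0 y (cJ _ _)).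
    move=> {}y z cy /orP[]/eqP->; first by apply: (connect_trans cy); apply: stp; rewrite /adj /= ?eqxx.
    case: (eqVneq y (root J)) => [->|yN]; first by rewrite root_univalent.
    by apply: (connect_trans cy); apply: stp; rewrite /adj /= (negPf yN) eqxx orbT.
split=> //.
- by move=> x y; apply: connect_trans (cr y); rewrite sym.
- apply/(eulerE oK oN n3).
  have := cardC (univalent prod_graph); rewrite card_prod_univalent !card_sum card_bool.
  have := cardC (univalent I); have := cardC (univalent J).
  have := rtree_euler I; have := rtree_euler J.
  have := card_univalent I; have := card_univalent J; lia.
- move=> d; rewrite prod_univalent; case: d => [[x|y]|[]] //=.
    by rewrite negb_and negbK => /orP[/lI //|/eqP ->]; exact: root_lab.
  by rewrite negb_and negbK => /orP[/lJ //|/eqP ->]; exact: root_lab.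
Qed.

Fact prod_is_rooted : is_rooted prod_graph (inr true).
Proof.
split; first exact: prod_is_tree.
move=> d; rewrite prod_univalent; case: d => [[x|y]|[]] //=.
  by case: (boolP (_ && (_ != _))) => [/andP[u n]|] //=; rewrite (negPf (rtree_lab u n)).
by case: (boolP (_ && (_ != _))) => [/andP[u n]|] //=; rewrite (negPf (rtree_lab u n)).
Qed.

Definition rprod : rtree m := RTree prod_is_rooted.

Lemma tree_order_rprod : tree_order rprod = (tree_order I + tree_order J).+1.
Proof.
have := orderE (nxt3 prod_is_tree); have := orderE (nxt3 (rtree_tree I)).
have := orderE (nxt3 (rtree_tree J)).
have := cardC (univalent prod_graph); rewrite card_prod_univalent !card_sum card_bool.
have := cardC (univalent I); have := cardC (univalent J).
have := card_univalent I; have := card_univalent J; rewrite /=; lia.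
Qed.

End Product.

Section Inner.
Variables (m : nat) (I J : rtree m).

(* The halves of the two root edges located at the roots are deleted, and the
   two remaining halves are matched with each other.                          *)
Definition unrooted_dart (K : rtree m) : finType := {d : rdart K | d != root K}.
Definition inner_dart : finType := (unrooted_dart I + unrooted_dart J)%type.

Definition stub (K : rtree m) : unrooted_dart K :=
  Sub (opp K (root K)) (opp_neq (rtree_tree K) (root K)).

Definition inner_opp (d : inner_dart) : inner_dart :=
  match d with
  | inl x => if insub (opp I (val x)) is Some x' then inl x' else inr (stub J)
  | inr y => if insub (opp J (val y)) is Some y' then inr y' else inl (stub I)
  end.

Fact nxt_unrooted (K : rtree m) (d : unrooted_dart K) : nxt K (val d) != root K.
Proof. by rewrite nxt_root (valP d). Qed.

Definition inner_nxt (d : inner_dart) : inner_dart :=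
  match d with
  | inl x => inl (Sub (nxt I (val x)) (nxt_unrooted x))
  | inr y => inr (Sub (nxt J (val y)) (nxt_unrooted y))
  end.

Definition inner_lab (d : inner_dart) : option 'I_m :=
  match d with inl x => lab I (val x) | inr y => lab J (val y) end.

Definition inner_graph : graph m inner_dart := Graph inner_opp inner_nxt inner_lab.

Lemma inner_univalent d : univalent inner_graph d =
  match d with inl x => univalent I (val x) | inr y => univalent J (val y) end.
Proof. by case: d. Qed.

Lemma card_unrooted (K : rtree m) (P : pred (rdart K)) :
  #|[pred d : unrooted_dart K | P (val d)]| = #|[pred d | P d && (d != root K)]|.
Proof.
rewrite -(card_image val_inj); apply: eq_card => d; apply/imageP/idP.
  by case=> x; rewrite !inE => Px ->; rewrite Px (valP x).
by rewrite !inE => /andP[Pd dN]; exists (Sub d dN).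
Qed.

Lemma card_inner_univalent :
  (#|univalent inner_graph| = #|univalent I|.-1 + #|univalent J|.-1)%N.
Proof. by rewrite !card_univalent /= -!card_unrooted -!sum1_card big_sumType. Qed.

Lemma card_inner : (#|inner_dart| = #|rdart I|.-1 + #|rdart J|.-1)%N.
Proof.
by rewrite card_sum !card_sig -!(cardC1 (root _)); congr (_ + _)%N; apply: eq_card.
Qed.

Lemma inner_is_tree : is_tree inner_graph.
Proof.
have [oKI oNI n3I cI _ lI] := rtree_tree I; have [oKJ oNJ n3J cJ _ lJ] := rtree_tree J.
have oK : involutive (opp inner_graph).
  case=> [x|y] /=.
  - case: insubP => [x' _ e|] /=.
      by rewrite e oKI valK.
    rewrite negbK => /eqP e; rewrite insubF ?oKJ ?eqxx //=.
    by congr inl; apply: val_inj; exact: etrans (congr1 _ (esym e)) (oKI _).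
  - case: insubP => [x' _ e|] /=.
      by rewrite e oKJ valK.
    rewrite negbK => /eqP e; rewrite insubF ?oKI ?eqxx //=.
    by congr inr; apply: val_inj; exact: etrans (congr1 _ (esym e)) (oKJ _).
have oN d : opp inner_graph d != d.
  case: d => [x|y] /=; case: insubP => [x' _ e|] //=.
    by apply/eqP=> -[xx]; have := oNI (val x); rewrite -e xx eqxx.
  by apply/eqP=> -[xx]; have := oNJ (val y); rewrite -e xx eqxx.
have n3 d : nxt inner_graph (nxt inner_graph (nxt inner_graph d)) = d.
  by case: d => [x|y] /=; [congr inl | congr inr]; apply: val_inj; rewrite /= ?n3I ?n3J.
have sym := connect_adj_sym oK n3.
have stp x y : adj inner_graph x y -> connect (adj inner_graph) x y by exact: connect1.
pose r : inner_dart := inl (stub I).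
have ind_path (T : finType) (e : rel T) (P : T -> Prop) x :
    (forall y z, P y -> e y z -> P z) -> P x -> forall y, connect e x y -> P y.
  move=> st Px y /connectP[p]; elim: p x Px => [|z p IH] x Px /= => [_ ->//|/andP[xz zp]].
  exact: (IH z (st _ _ Px xz) zp).
have cJ0 : connect (adj inner_graph) r (inr (stub J)).
  by apply: stp; rewrite /adj /= insubF ?eqxx // oKI eqxx.
have cr d : connect (adj inner_graph) r d.
  case: d => [x|y].
  - apply: (ind_path _ _ (fun z => forall x : unrooted_dart I, val x = z ->
        connect (adj inner_graph) r (inl x)) _ _ _ _ (cI (root I) (val x)) x erefl); last first.
      by move=> {}x e; case/negP: (valP x); apply/eqP.
    move=> y z Py + {}x xz; rewrite -{z}xz /= => yz.
    have [yr|yN] := eqVneq y (root I).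
      suff -> : x = stub I by exact: connect0.
      apply: val_inj; move: yz; rewrite /adj /= yr root_univalent => /orP[/eqP//|/eqP e].
      by case/negP: (valP x); apply/eqP.
    apply: (connect_trans (Py (Sub y yN) erefl)); apply: stp; rewrite /adj /=.
    case/orP: yz => /eqP e; last by apply/orP; right; apply/eqP; congr inl; apply: val_inj.
    by rewrite -e valK eqxx.
  - apply: (ind_path _ _ (fun z => forall x : unrooted_dart J, val x = z ->
        connect (adj inner_graph) r (inr x)) _ _ _ _ (cJ (root J) (val y)) y erefl); last first.
      by move=> {}x e; case/negP: (valP x); apply/eqP.
    move=> {}y z Py + x xz; rewrite -{z}xz /= => yz.
    have [yr|yN] := eqVneq y (root J).
      suff -> : x = stub J by exact: cJ0.
      apply: val_inj; move: yz; rewrite /adj /= yr root_univalent => /orP[/eqP//|/eqP e].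
      by case/negP: (valP x); apply/eqP.
    apply: (connect_trans (Py (Sub y yN) erefl)); apply: stp; rewrite /adj /=.
    case/orP: yz => /eqP e; last by apply/orP; right; apply/eqP; congr inr; apply: val_inj.
    by rewrite -e valK eqxx.
split=> //.
- by move=> x y; apply: connect_trans (cr y); rewrite sym.
- apply/(eulerE oK oN n3).
  have := cardC (univalent inner_graph); rewrite card_inner_univalent card_inner.
  have := cardC (univalent I); have := cardC (univalent J).
  have := rtree_euler I; have := rtree_euler J.
  have := card_univalent I; have := card_univalent J; lia.
- by move=> d; rewrite inner_univalent; case: d => [x|y] /=; [apply: lI | apply: lJ].
Qed.

Fact inner_is_unrooted : is_unrooted inner_graph.
Proof.
split; first exact: inner_is_tree.
move=> d; rewrite inner_univalent; case: d => [x|y] /= u.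
  exact: rtree_lab u (valP x).
exact: rtree_lab u (valP y).
Qed.

Definition inner : utree m := UTree inner_is_unrooted.

Lemma tree_order_inner : tree_order inner = (tree_order I + tree_order J)%N.
Proof.
have := orderE (nxt3 inner_is_tree); have := orderE (nxt3 (rtree_tree I)).
have := orderE (nxt3 (rtree_tree J)).
have := cardC (univalent inner_graph); rewrite card_inner_univalent card_inner.
have := cardC (univalent I); have := cardC (univalent J).
have := card_univalent I; have := card_univalent J; rewrite /=; lia.
Qed.

End Inner.

(* Trees whose half-edges are the elements of some 'I_k, so that generators form
   a type small enough to be a choiceType; [rgen_exists] and [ugen_exists] show
   that every isomorphism class of trees is represented.                       *)
Record rgen (m n : nat) := RGen {
  rgen_size : nat;
  rgen_graph : graph m 'I_rgen_size;
  rgen_root : 'I_rgen_size;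
  rgenP : is_rooted rgen_graph rgen_root;
  rgen_order : tree_order rgen_graph = n }.

Record ugen (m n : nat) := UGen {
  ugen_size : nat;
  ugen_graph : graph m 'I_ugen_size;
  ugenP : is_unrooted ugen_graph;
  ugen_order : tree_order ugen_graph = n }.

HB.instance Definition _ m n := gen_eqMixin (rgen m n).
HB.instance Definition _ m n := gen_choiceMixin (rgen m n).
HB.instance Definition _ m n := gen_eqMixin (ugen m n).
HB.instance Definition _ m n := gen_choiceMixin (ugen m n).

Coercion rtree_of_rgen m n (J : rgen m n) : rtree m := RTree (rgenP J).
Coercion utree_of_ugen m n (t : ugen m n) : utree m := UTree (ugenP t).

Section IsoTree.
Variables (m : nat) (D D' : finType) (g : graph m D) (g' : graph m D').
Variable f : D -> D'.
Hypotheses (fbij : bijective f) (fopp : {morph f : d / opp g d >-> opp g' d}).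
Hypotheses (fnxt : {morph f : d / nxt g d >-> nxt g' d}).
Hypotheses (flab : forall d, lab g' (f d) = lab g d).

Let finj : injective f := bij_inj fbij.

Fact iso_univalent d : univalent g' (f d) = univalent g d.
Proof. by rewrite /univalent /= -fnxt (inj_eq finj). Qed.

Fact iso_card (P : pred D) (P' : pred D') : (forall d, P' (f d) = P d) -> #|P'| = #|P|.
Proof.
move=> PP; have [h hf fh] := fbij.
rewrite -(card_image finj P); apply: eq_card => y; rewrite -[y]fh.
by rewrite (mem_image finj) !unfold_in PP.
Qed.

Lemma iso_tree : is_tree g -> is_tree g'.
Proof.
have [h hf fh] := fbij; case=> oK oN n3 c e l.
have oK' : involutive (opp g') by move=> y; rewrite -[y]fh -!fopp oK.
have oN' y : opp g' y != y by rewrite -[y]fh -fopp (inj_eq finj).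
have n3' y : nxt g' (nxt g' (nxt g' y)) = y by rewrite -[y]fh -!fnxt n3.
split=> //.
- move=> x y; rewrite -[x]fh -[y]fh; move: (h x) (h y) => {}x {}y.
  case/connectP: (c x y) => p; elim: p x => [|z p IH] x /= => [_ -> //|].
  case/andP=> xz zp /(IH z zp); apply: connect_trans; apply: connect1.
  by case/orP: xz => /eqP ->; rewrite /adj /= (fopp, fnxt) ?fopp ?fnxt eqxx ?orbT.
- apply/(eulerE oK' oN' n3'); rewrite (iso_card iso_univalent).
  rewrite (@iso_card [predC univalent g] [predC univalent g']) => [|d].
    exact/(eulerE oK oN n3).
  by rewrite -[LHS]/(~~ univalent g' (f d)) iso_univalent.
- by move=> y; rewrite -[y]fh iso_univalent flab; apply: l.
Qed.

Lemma iso_tree_order : is_tree g -> tree_order g' = tree_order g.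
Proof.
move=> gT; apply/eqP; rewrite -(eqn_pmul2r (isT : 0 < 3)%N).
rewrite (orderE (nxt3 gT)) (orderE (nxt3 (iso_tree gT))); apply/eqP.
by apply: iso_card => d; rewrite -[LHS]/(~~ univalent g' (f d)) iso_univalent.
Qed.

Lemma iso_rooted r : is_rooted g r -> is_rooted g' (f r).
Proof.
have [h hf fh] := fbij; case=> gT gr; split=> [|y]; first exact: iso_tree.
by rewrite -[y]fh iso_univalent flab gr (inj_eq finj).
Qed.

Lemma iso_unrooted : is_unrooted g -> is_unrooted g'.
Proof.
have [h hf fh] := fbij; case=> gT gr; split=> [|y]; first exact: iso_tree.
by rewrite -[y]fh iso_univalent flab; apply: gr.
Qed.

End IsoTree.

Definition ord_graph (m : nat) (D : finType) (g : graph m D) : graph m 'I_#|D| :=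
  Graph (fun i => enum_rank (opp g (enum_val i)))
        (fun i => enum_rank (nxt g (enum_val i))) (fun i => lab g (enum_val i)).

Section OrdGraph.
Variables (m : nat) (D : finType) (g : graph m D).
Let r : D -> 'I_#|D| := enum_rank.

Fact ord_graph_opp : {morph r : d / opp g d >-> opp (ord_graph g) d}.
Proof. by move=> d; rewrite /= enum_rankK. Qed.
Fact ord_graph_nxt : {morph r : d / nxt g d >-> nxt (ord_graph g) d}.
Proof. by move=> d; rewrite /= enum_rankK. Qed.
Fact ord_graph_lab d : lab (ord_graph g) (r d) = lab g d.
Proof. by rewrite /= enum_rankK. Qed.

Lemma ord_graph_iso : iso g (ord_graph g).
Proof.
exists r; split; [exact: enum_rank_bij | exact: ord_graph_opp
  | exact: ord_graph_nxt | exact: ord_graph_lab].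
Qed.

End OrdGraph.

Lemma rgen_exists m (J : rtree m) : exists J' : rgen m (tree_order J), iso J J'.
Proof.
have P := iso_rooted (@enum_rank_bij _) (@ord_graph_opp _ _ J) (@ord_graph_nxt _ _ J)
  (@ord_graph_lab _ _ J) (rtreeP J).
have o := iso_tree_order (@enum_rank_bij _) (@ord_graph_opp _ _ J) (@ord_graph_nxt _ _ J)
  (@ord_graph_lab _ _ J) (rtree_tree J).
by exists (RGen P o); exact: ord_graph_iso.
Qed.

Lemma ugen_exists m (t : utree m) : exists t' : ugen m (tree_order t), iso t t'.
Proof.
have P := iso_unrooted (@enum_rank_bij _) (@ord_graph_opp _ _ t) (@ord_graph_nxt _ _ t)
  (@ord_graph_lab _ _ t) (utreeP t).
have o := iso_tree_order (@enum_rank_bij _) (@ord_graph_opp _ _ t) (@ord_graph_nxt _ _ t)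
  (@ord_graph_lab _ _ t) (proj1 (utreeP t)).
by exists (UGen P o); exact: ord_graph_iso.
Qed.

(* [g'] is obtained from [g] by reversing the orientation at one trivalent vertex *)
Definition reversal (m : nat) (D D' : finType) (g : graph m D) (g' : graph m D') : Prop :=
  exists2 v : D, ~~ univalent g v & iso (reverse_at g v) g'.

(* The common part of the three trees is built up by rooted products, starting
   from the subtrees in which they differ.                                    *)
Inductive ihx_triple (m : nat) : rtree m -> rtree m -> rtree m -> Prop :=
| ihx_base A B C :
    ihx_triple (rprod (rprod A B) C) (rprod A (rprod B C)) (rprod (rprod C A) B)
| ihx_prodl I H X K :
    ihx_triple I H X -> ihx_triple (rprod I K) (rprod H K) (rprod X K)
| ihx_prodr I H X K :
    ihx_triple I H X -> ihx_triple (rprod K I) (rprod K H) (rprod K X)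
| ihx_iso (I H X I' H' X' : rtree m) :
    ihx_triple I H X -> iso I I' -> iso H H' -> iso X X' -> ihx_triple I' H' X'.

Section Groups.
Variables m n : nat.

Inductive lie_rel : {freeg (rgen m n)} -> Prop :=
| lie_iso (J J' : rgen m n) : iso J J' -> lie_rel (<< J >> - << J' >>)
| lie_AS (J J' : rgen m n) : reversal J J' -> lie_rel (<< J >> + << J' >>)
| lie_IHX (I H X : rgen m n) :
    ihx_triple I H X -> lie_rel (<< I >> - << H >> + << X >>).

Definition lie_group : zmodType := quotg lie_rel.
Definition lie_class (J : rgen m n) : lie_group := quotg_pi lie_rel << J >>.

Inductive tree_rel : {freeg (ugen m n)} -> Prop :=
| tree_iso (t t' : ugen m n) : iso t t' -> tree_rel (<< t >> - << t' >>)
| tree_AS (t t' : ugen m n) : reversal t t' -> tree_rel (<< t >> + << t' >>)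
| tree_IHX (A B C D : rtree m) (I H X : ugen m n) :
    iso (inner (rprod (rprod A B) C) D) I ->
    iso (inner (rprod A (rprod B C)) D) H ->
    iso (inner (rprod (rprod C A) B) D) X ->
    tree_rel (<< I >> - << H >> + << X >>).

Definition tree_group : zmodType := quotg tree_rel.
Definition tree_class (t : ugen m n) : tree_group := quotg_pi tree_rel << t >>.

End Groups.

Section Twisted.
Variables m n : nat.

(* The direct sum of T_{2n} and the free group on the symbols J^oo. *)
Definition free_twisted : zmodType :=
  (tree_group m (2 * n) * {freeg (rgen m n)})%type.

Inductive twisted_rel : free_twisted -> Prop :=
| twisted_iso (J J' : rgen m n) : iso J J' -> twisted_rel (0, << J >> - << J' >>)
| twisted_sym (J J' : rgen m n) : reversal J J' -> twisted_rel (0, << J >> - << J' >>)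
| twisted_double (J : rgen m n) (t : ugen m (2 * n)) :
    iso (inner J J) t -> twisted_rel (- tree_class t, << J >> *+ 2)
| twisted_IHX (I H X : rgen m n) (t : ugen m (2 * n)) :
    ihx_triple I H X -> iso (inner H X) t ->
    twisted_rel (tree_class t, << I >> - << H >> - << X >>).

Definition twisted_group : zmodType := quotg twisted_rel.

Definition twisted_tree (t : ugen m (2 * n)) : twisted_group :=
  quotg_pi twisted_rel (tree_class t, 0).
Definition twisted_class (J : rgen m n) : twisted_group :=
  quotg_pi twisted_rel (0, << J >>).

End Twisted.

(* Main.v *)
From HB Require Import structures.
From mathcomp Require Import all_boot all_order all_algebra.
From mathcomp Require Import boolp.
From mathcomp.multinomials Require Import freeg.
Require Import Defs.

Set Implicit Arguments.
Unset Strict Implicit.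
Unset Printing Implicit Defensive.

Import GRing.Theory.
Local Open Scope ring_scope.

(** The whole content is the injectivity of T_{2n} -> T^oo_{2n}, and it comes from
    reading T^oo_{2n} as the target of a universal quadratic refinement of the
    inner product.  Write L = L_n, T = T_{2n}.

    Gluing along roots descends to a symmetric biadditive form b : L x L -> T
    ([lie_form]).  Reversing the orientation at a vertex of a factor reverses it in
    the inner product, which settles AS; for IHX one uses that the trees <(A,B),C>
    and <A,(B,C)> are isomorphic ([inner_rprod]), so that the part of an IHX triple
    surrounding the place of modification can be moved, one product at a time,
    into the other argument of the inner product until the IHX relation of T is
    reached ([inner_ihx]).

    For any symmetric form b : L x L -> T the set T x L is an abelian group under
    (t, x) + (s, y) = (t + s - b x y, x + y), and q x = (0, x) satisfies
    q (x + y) = q x + q y + b x y.  Sending J^oo to q [J] turns every relation of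
    T^oo into an element 2 (q x) - b x x for some x in L ([twisted_rel_relator]).
    Such elements are the pairs (- 2 (b x x), 2 x); they form a subgroup, as
    x |-> 2 (q x) - b x x is additive ([ext_relator]), and this subgroup meets T
    trivially: if 2 x = 0 then 2 (b x x) = b (2 x) x = 0 ([ext_incl_relator]).
    Hence an element of T that dies in T^oo was already zero.

    The rest is formal.  Modulo the image of T the relations of T^oo say that
    the symbols J^oo satisfy the relations of L ([twisted_free_lie_rel]) and are
    killed by 2, while 1 (x) y = 0 in Z/2 (x) L forces y into 2 L ([tens1_eq0]),
    whence exactness in the middle ([twisted_exact]); surjectivity holds as Z/2 has only the elements 0 and 1. *)

(** * Free abelian groups and quotients *)

Section FreeLift.
Variables (K : choiceType) (M : zmodType).

(** The integer module structure of M has to be summoned by [zmodule] before the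
    linear extension of f applies. *)
Definition free_lift (f : K -> M) (x : {freeg K}) : M :=
  @fglift int (zmodule M) K f x.

Fact free_lift_is_zmod_morphism f : zmod_morphism (free_lift f).
Proof. exact: (@lift_is_additive int K (zmodule M) f). Qed.
HB.instance Definition _ f :=
  GRing.isZmodMorphism.Build {freeg K} M (free_lift f) (free_lift_is_zmod_morphism f).

Lemma free_lift_gen f k : free_lift f << k >> = f k.
Proof. by rewrite /free_lift (liftU (M := zmodule M)) scale1r. Qed.

End FreeLift.

Lemma free_ind (K : choiceType) (P : {freeg K} -> Prop) :
    P 0 -> (forall k, P << k >>) -> (forall x y, P x -> P y -> P (x - y)) ->
  forall x, P x.
Proof.
move=> P0 Pgen PB.
have PN x : P x -> P (- x) by move=> Px; rewrite -[- x]add0r; exact: PB.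
have PD x y : P x -> P y -> P (x + y).
  by move=> Px Py; rewrite -[y]opprK; apply: PB => //; exact: PN.
have PM x n : P x -> P (x *+ n).
  by move=> Px; elim: n => [|n IH]; rewrite ?mulr0n // mulrS; exact: PD.
move=> x; rewrite -[x]freeg_sumE; elim/big_rec: _ => // k y _ Py; apply: PD => //.
rewrite -[X in << X *g k >>]intz -freegU_mulz; case: (coeff k x) => n.
  by rewrite -pmulrn; exact: PM.
by rewrite NegzE mulrNz -pmulrn; apply: PN; exact: PM.
Qed.

Section QuotientTheory.
Variables (V : zmodType) (R : V -> Prop).

Fact quotg_pi_is_zmod_morphism : zmod_morphism (quotg_pi R).
Proof. by move=> x y; rewrite /quotg_pi raddfB. Qed.
HB.instance Definition _ :=
  GRing.isZmodMorphism.Build V (quotg R) (quotg_pi R) quotg_pi_is_zmod_morphism.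

Lemma quotg_surj (u : quotg R) : exists x, quotg_pi R x = u.
Proof. by exists (repr u); exact: reprK. Qed.

Lemma quotg_eq0 x : quotg_pi R x = 0 <-> generated R x.
Proof.
rewrite -(raddf0 (quotg_pi R)); split=> [/eqP|gx].
  by rewrite /quotg_pi -Quotient.idealrBE subr0 => /gen_subP.
by apply/eqP; rewrite /quotg_pi -Quotient.idealrBE subr0; exact/gen_subP.
Qed.

Lemma quotg_rel x : R x -> quotg_pi R x = 0.
Proof. by move=> Rx; apply/quotg_eq0/generated_rel. Qed.

Section Lift.
Variables (W : zmodType) (f : {additive V -> W}).
Hypothesis fR : forall x, R x -> f x = 0.

(** The proof that f kills R is an argument of the term, so that the additivity
    instance can be inferred from the term alone. *)
Definition quotg_lift of (forall x, R x -> f x = 0) := fun u : quotg R => f (repr u).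

Lemma generated_ker x : generated R x -> f x = 0.
Proof. by elim=> [y /fR|| y z _ fy _ fz] //; rewrite ?raddf0 // raddfB fy fz subrr. Qed.

Lemma quotg_lift_pi x : quotg_lift fR (quotg_pi R x) = f x.
Proof.
apply/eqP; rewrite -subr_eq0 -raddfB; apply/eqP/generated_ker/quotg_eq0.
by rewrite raddfB; apply/eqP; rewrite subr_eq0; apply/eqP; exact: reprK.
Qed.

Fact quotg_lift_is_zmod_morphism : zmod_morphism (quotg_lift fR).
Proof.
move=> u v; have [x <-] := quotg_surj u; have [y <-] := quotg_surj v.
by rewrite -raddfB !quotg_lift_pi raddfB.
Qed.
HB.instance Definition _ :=
  GRing.isZmodMorphism.Build (quotg R) W (quotg_lift fR) quotg_lift_is_zmod_morphism.

End Lift.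
End QuotientTheory.

(** * Symmetric biadditive forms *)

Record sym_form (L T : zmodType) := SymForm {
  form :> L -> L -> T;
  formC : forall x y, form x y = form y x;
  formBl : forall x y z, form (x - y) z = form x z - form y z }.

Section SymFormTheory.
Variables (L T : zmodType) (b : sym_form L T).

Lemma form0l z : b 0 z = 0.
Proof. by rewrite -[X in b X _](subrr 0) formBl subrr. Qed.
Lemma formNl x z : b (- x) z = - b x z.
Proof. by rewrite -sub0r formBl form0l sub0r. Qed.
Lemma formDl x y z : b (x + y) z = b x z + b y z.
Proof. by rewrite -[y]opprK formBl !formNl !opprK. Qed.
Lemma formDr x y z : b z (x + y) = b z x + b z y.
Proof. by rewrite formC formDl !(formC b z). Qed.
Lemma formNr x z : b z (- x) = - b z x.
Proof. by rewrite formC formNl formC. Qed.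
Lemma form0r z : b z 0 = 0.
Proof. by rewrite formC form0l. Qed.

End SymFormTheory.

Section FreeForm.
Variables (K : choiceType) (T : zmodType) (f : K -> K -> T).
Hypothesis fC : forall j k, f j k = f k j.

(** Extending first in one variable and then in the other makes additivity in the
    second variable immediate; additivity in the first is proved on generators. *)
Definition free_form_fun (x y : {freeg K}) : T :=
  free_lift (fun k => free_lift (f^~ k) x) y.

Lemma free_form_gen j k : free_form_fun << j >> << k >> = f j k.
Proof. by rewrite /free_form_fun !free_lift_gen. Qed.

Lemma free_form_Br z x y :
  free_form_fun z (x - y) = free_form_fun z x - free_form_fun z y.
Proof. exact: raddfB. Qed.

Lemma free_form_Bl x y z :
  free_form_fun (x - y) z = free_form_fun x z - free_form_fun y z.
Proof.
elim/free_ind: z => [|k|z w IHz IHw].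
- by rewrite /free_form_fun !raddf0 addr0.
- by rewrite /free_form_fun !free_lift_gen raddfB.
- by rewrite !free_form_Br IHz IHw !opprD !opprK addrACA.
Qed.

Lemma free_form_0l z : free_form_fun 0 z = 0.
Proof. by rewrite -[X in free_form_fun X _](subrr 0) free_form_Bl subrr. Qed.

Lemma free_form_0r z : free_form_fun z 0 = 0.
Proof. exact: raddf0. Qed.

Lemma free_form_C x y : free_form_fun x y = free_form_fun y x.
Proof.
elim/free_ind: x y => [|j|x z IHx IHz] y; last first.
- by rewrite free_form_Bl IHx IHz free_form_Br.
- elim/free_ind: y => [|k|y z IHy IHz]; last first.
  + by rewrite free_form_Bl -IHy -IHz free_form_Br.
  + by rewrite !free_form_gen.
  + by rewrite free_form_0l free_form_0r.
- by rewrite free_form_0l free_form_0r.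
Qed.

Definition free_form : sym_form {freeg K} T := SymForm free_form_C free_form_Bl.

End FreeForm.

Section QuotForm.
Variables (V T : zmodType) (R : V -> Prop) (b : sym_form V T).
Hypothesis bR : forall r v, R r -> b r v = 0.

Definition quot_form_fun (x y : quotg R) : T := b (repr x) (repr y).

Lemma form_generated r v : generated R r -> b r v = 0.
Proof.
by elim=> [x /bR|| x y _ bx _ by0] //; rewrite ?form0l // formBl bx by0 subrr.
Qed.

(** Symmetry carries independence of the first representative over to the second. *)
Lemma quot_form_funE x y : quot_form_fun (quotg_pi R x) (quotg_pi R y) = b x y.
Proof.
have reprB v : generated R (repr (quotg_pi R v) - v).
  apply/quotg_eq0; rewrite raddfB; apply/eqP; rewrite subr_eq0; apply/eqP.
  exact: reprK.
rewrite /quot_form_fun -[X in b X _](subrK x) formDl form_generated // add0r.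
by rewrite formC -[X in b X _](subrK y) formDl form_generated // add0r formC.
Qed.

Lemma quot_form_C x y : quot_form_fun x y = quot_form_fun y x.
Proof. exact: formC. Qed.

Lemma quot_form_Bl x y z :
  quot_form_fun (x - y) z = quot_form_fun x z - quot_form_fun y z.
Proof.
have [{}x <-] := quotg_surj x; have [{}y <-] := quotg_surj y.
by have [{}z <-] := quotg_surj z; rewrite -raddfB !quot_form_funE formBl.
Qed.

Definition quot_form : sym_form (quotg R) T := SymForm quot_form_C quot_form_Bl.

End QuotForm.

(** * The extension defined by a symmetric form *)

Section Extension.
Variables (L T : zmodType) (b : sym_form L T).

(** The form is a parameter of the carrier because it determines the group law:
    a symmetric biadditive form is a symmetric 2-cocycle, hence defines an abelian
    extension of L by T. *)
Definition extension of sym_form L T : Type := (T * L)%type.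
HB.instance Definition _ := Choice.copy (extension b) (T * L)%type.

Implicit Types u v w : extension b.

Definition ext_zero : extension b := (0, 0).
Definition ext_opp u : extension b := (- u.1 - b u.2 u.2, - u.2).
Definition ext_add u v : extension b := (u.1 + v.1 - b u.2 v.2, u.2 + v.2).

Fact ext_addA : associative ext_add.
Proof.
case=> [t x] [s y] [r z]; rewrite /ext_add /= (addrA x); congr pair.
rewrite formDl formDr !opprD !addrA [in RHS](addrAC _ (- b x y) r).
by rewrite [in LHS](addrAC _ (- b y z) (- b x y)) [LHS]addrAC.
Qed.

Fact ext_addC : commutative ext_add.
Proof. by case=> [t x] [s y]; rewrite /ext_add /= (addrC t) (addrC x) formC. Qed.

Fact ext_add0 : left_id ext_zero ext_add.
Proof. by case=> [t x]; rewrite /ext_add /= form0l subr0 !add0r. Qed.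

Fact ext_addN : left_inverse ext_zero ext_opp ext_add.
Proof.
case=> [t x]; rewrite /ext_add /ext_opp /ext_zero /= formNl opprK addNr.
by rewrite addrAC subrK addNr.
Qed.

HB.instance Definition _ :=
  GRing.isZmodule.Build (extension b) ext_addA ext_addC ext_add0 ext_addN.

Lemma ext_addE (t s : T) (x y : L) :
  ((t, x) : extension b) + (s, y) = (t + s - b x y, x + y).
Proof. by []. Qed.

Lemma ext_oppE (t : T) (x : L) : - ((t, x) : extension b) = (- t - b x x, - x).
Proof. by []. Qed.

Definition ext_incl (t : T) : extension b := (t, 0).
Definition ext_quad (x : L) : extension b := (0, x).

Fact ext_incl_is_zmod_morphism : zmod_morphism ext_incl.
Proof. by move=> t s; rewrite /ext_incl ext_oppE ext_addE oppr0 form0l addr0 !subr0. Qed.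
HB.instance Definition _ :=
  GRing.isZmodMorphism.Build T (extension b) ext_incl ext_incl_is_zmod_morphism.

(** [ext_quad] is a quadratic refinement of b: this is what the cocycle is for. *)
Lemma ext_quadD x y : ext_quad (x + y) = ext_quad x + ext_quad y + ext_incl (b x y).
Proof. by rewrite /ext_quad /ext_incl !ext_addE form0r subr0 !addr0 add0r addNr. Qed.

Lemma ext_quadN x : ext_quad (- x) = ext_incl (b x x) - ext_quad x.
Proof.
apply/eqP; rewrite eq_sym subr_eq; apply/eqP.
by rewrite /ext_quad /ext_incl ext_addE formNl opprK !add0r addNr.
Qed.

(** What has to vanish for [ext_quad] to satisfy 2 (q x) = b x x, as the doubling
    relation of the twisted group demands. *)
Definition ext_relator (x : L) : extension b := ext_quad x *+ 2 - ext_incl (b x x).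

Lemma ext_quadNE x : ext_quad (- x) = ext_quad x - ext_relator x.
Proof. by rewrite ext_quadN /ext_relator mulr2n opprB addrCA opprD addNKr. Qed.

(** The shape of the twisted IHX relation, for which the class of the first tree
    is the difference of the classes of the other two. *)
Lemma ext_quadB x y :
  ext_incl (b x y) + (ext_quad (x - y) - ext_quad x - ext_quad y) = - ext_relator y.
Proof.
rewrite ext_quadD formNr raddfN /= ext_quadNE.
rewrite (addrAC _ (- ext_incl _)) (addrAC _ (- ext_incl _)) [LHS]addrC subrK.
by rewrite (addrC (ext_quad x)) addrK addrAC subrr add0r.
Qed.

(** The quadratic terms cancel: both 2 (q x) and b x x deviate from additivity by
    2 (b x y).  Thus the relators form a subgroup. *)
Fact ext_relator_is_zmod_morphism : zmod_morphism ext_relator.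
Proof.
suff relatorD x y : ext_relator (x + y) = ext_relator x + ext_relator y.
  by move=> x y; rewrite -[in RHS](subrK y x) (relatorD (x - y)) addrK.
rewrite /ext_relator ext_quadD !mulrnDl -raddfMn /= formDl !formDr (formC b y x).
rewrite [RHS]addrACA -[LHS]addrA; congr (_ + _).
rewrite -opprD -raddfB -raddfD -raddfN /=; congr ext_incl.
by rewrite addrA -(addrA (b x x)) -mulr2n addrAC [in LHS]opprD addrCA subrr addr0.
Qed.
HB.instance Definition _ :=
  GRing.isZmodMorphism.Build L (extension b) ext_relator ext_relator_is_zmod_morphism.

Lemma ext_relatorE x : ext_relator x = (- (b x x *+ 2), x *+ 2).
Proof.
rewrite /ext_relator /ext_quad /ext_incl mulr2n ext_oppE !ext_addE.
by rewrite oppr0 !form0r !subr0 !addr0 add0r -opprD -mulr2n.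
Qed.

(** Since b is biadditive, 2 x = 0 implies 2 (b x x) = 0. *)
Lemma ext_incl_relator t x : ext_incl t = ext_relator x -> t = 0.
Proof.
rewrite ext_relatorE => -[-> x2].
by rewrite mulr2n -formDl -mulr2n -x2 form0l oppr0.
Qed.

End Extension.

(** * Isomorphisms of trees and the inner product *)

Lemma iso_sym m (D D' : finType) (g : graph m D) (g' : graph m D') :
  iso g g' -> iso g' g.
Proof.
case=> f [[h hf fh] fo fn fl]; exists h; split.
- by exists f.
- by move=> d; rewrite -{1}[d]fh -fo hf.
- by move=> d; rewrite -{1}[d]fh -fn hf.
- by move=> d; rewrite -{2}[d]fh fl.
Qed.

Lemma iso_trans m (D D' D'' : finType)
    (g : graph m D) (g' : graph m D') (g'' : graph m D'') :
  iso g g' -> iso g' g'' -> iso g g''.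
Proof.
case=> f [fb fo fn fl] [f' [fb' fo' fn' fl']]; exists (f' \o f); split.
- exact: bij_comp.
- by move=> d /=; rewrite fo fo'.
- by move=> d /=; rewrite fn fn'.
- by move=> d /=; rewrite fl' fl.
Qed.

Lemma iso_root m (I J : rtree m) (f : rdart I -> rdart J) :
    injective f -> {morph f : d / nxt I d >-> nxt J d} ->
    (forall d, lab J (f d) = lab I d) ->
  f (root I) = root J.
Proof.
move=> finj fn fl; apply/eqP; rewrite -(proj2 (rtreeP J)) /univalent /=.
by rewrite -fn root_univalent eqxx fl root_lab.
Qed.

Definition nonroot m (K : rtree m) d (dN : d != root K) : unrooted_dart K := Sub d dN.

Section InnerOpp.
Variables (m : nat) (I J : rtree m).

Lemma inner_opp_inl (x x' : unrooted_dart I) :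
  opp I (val x) = val x' -> opp (inner I J) (inl x) = inl x'.
Proof. by move=> /= ->; rewrite valK. Qed.

Lemma inner_opp_inr (y y' : unrooted_dart J) :
  opp J (val y) = val y' -> opp (inner I J) (inr y) = inr y'.
Proof. by move=> /= ->; rewrite valK. Qed.

Lemma inner_opp_rootl (x : unrooted_dart I) :
  opp I (val x) = root I -> opp (inner I J) (inl x) = inr (stub J).
Proof. by move=> /= ->; rewrite insubF ?eqxx. Qed.

Lemma inner_opp_rootr (y : unrooted_dart J) :
  opp J (val y) = root J -> opp (inner I J) (inr y) = inl (stub I).
Proof. by move=> /= ->; rewrite insubF ?eqxx. Qed.

End InnerOpp.

Lemma inner_sym m (I J : rtree m) : iso (inner I J) (inner J I).
Proof.
pose sw (K L : rtree m) (d : inner_dart K L) : inner_dart L K :=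
  match d with inl x => inr x | inr y => inl y end.
exists (@sw I J); split.
- by exists (@sw J I); case.
- by case=> [x|y] /=; case: insubP.
- by case.
- by case.
Qed.

Lemma inner_isol m (I J K : rtree m) : iso I J -> iso (inner I K) (inner J K).
Proof.
case=> f [fb fo fn fl]; have finj := bij_inj fb.
have fr : f (root I) = root J by exact: iso_root.
have fN (d : unrooted_dart I) : f (val d) != root J.
  by rewrite -fr (inj_eq finj) (valP d).
pose F (d : inner_dart I K) : inner_dart J K :=
  match d with inl x => inl (Sub (f (val x)) (fN x)) | inr y => inr y end.
have Finj : injective F.
  by case=> [x|x] [y|y] //= [] => [/finj/val_inj ->|->].
have cardF : #|inner_dart I K| = #|inner_dart J K|.
  by rewrite !card_inner (bij_eq_card fb).
exists F; split.
- by apply: inj_card_bij => //; rewrite cardF.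
- case=> [x|y].
  + have [e|xN] := eqVneq (opp I (val x)) (root I).
      by rewrite (inner_opp_rootl _ e) inner_opp_rootl //= -fo e fr.
    rewrite (inner_opp_inl _ (x' := nonroot xN)) //.
    by rewrite (inner_opp_inl _ (x' := nonroot (fN (nonroot xN)))) //= fo.
  + have [e|yN] := eqVneq (opp K (val y)) (root K).
      rewrite (inner_opp_rootr _ e) inner_opp_rootr //=.
      by congr inl; apply: val_inj; rewrite /= fo fr.
    by rewrite !(inner_opp_inr _ (y' := nonroot yN)).
- by case=> [x|y] //=; congr inl; apply: val_inj; rewrite /= fn.
- by case=> [x|y] //=.
Qed.

(** Both sides are A, B and C glued to one trivalent vertex, with the same cyclic
    order.  The half-edges of the three stems at that vertex are represented
    differently: they are the roots of A and B and the new half-edge on the left,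
    the new half-edge and the roots of B and C on the right.  Hence F sends the
    root of A to the new half-edge, and the new half-edge to the root of C. *)
Lemma inner_rprod m (A B C : rtree m) :
  iso (inner (rprod A B) C) (inner A (rprod B C)).
Proof.
pose F (d : inner_dart (rprod A B) C) : inner_dart A (rprod B C) :=
  match d with
  | inl u => match val u with
    | inl (inl x) => if insub x is Some x' then inl x' else inr (Sub (inr false) isT)
    | inl (inr y) => inr (Sub (inl (inl y)) isT)
    | inr _ => inr (Sub (inl (inr (root C))) isT)
    end
  | inr z => inr (Sub (inl (inr (val z))) isT)
  end.
pose G (d : inner_dart A (rprod B C)) : inner_dart (rprod A B) C :=
  match d with
  | inl x => inl (Sub (inl (inl (val x))) isT)
  | inr u => match val u with
    | inl (inl y) => inl (Sub (inl (inr y)) isT)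
    | inl (inr z) => if insub z is Some z' then inr z' else inl (Sub (inr false) isT)
    | inr _ => inl (Sub (inl (inl (root A))) isT)
    end
  end.
have FK : cancel F G.
  case=> [[[[x|y]|[]] p]|z] //=.
  - case: insubP => [x' _ <-|] /=; first by congr inl; apply: val_inj.
    by rewrite negbK => /eqP ->; congr inl; apply: val_inj.
  - by congr inl; apply: val_inj.
  - by rewrite insubF ?eqxx //; congr inl; apply: val_inj.
  - by rewrite valK.
have GK : cancel G F.
  case=> [x|[[[y|z]|[]] p]] //=.
  - by rewrite valK.
  - by congr inr; apply: val_inj.
  - case: insubP => [z' _ <-|] /=; first by congr inr; apply: val_inj.
    by rewrite negbK => /eqP ->; congr inr; apply: val_inj.
  - by rewrite insubF ?eqxx //; congr inr; apply: val_inj.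
pose a x : unrooted_dart (rprod A B) := @nonroot _ (rprod A B) (inl (inl x)) isT.
pose b y : unrooted_dart (rprod A B) := @nonroot _ (rprod A B) (inl (inr y)) isT.
pose o : unrooted_dart (rprod A B) := @nonroot _ (rprod A B) (inr false) isT.
pose b' y : unrooted_dart (rprod B C) := @nonroot _ (rprod B C) (inl (inl y)) isT.
pose c' z : unrooted_dart (rprod B C) := @nonroot _ (rprod B C) (inl (inr z)) isT.
pose o' : unrooted_dart (rprod B C) := @nonroot _ (rprod B C) (inr false) isT.
have Fa (x : unrooted_dart A) : F (inl (a (val x))) = inl x by rewrite /= valK.
have Fa0 : F (inl (a (root A))) = inr o' by rewrite /= insubF ?eqxx.
have oE : stub (rprod A B) = o by apply: val_inj.
have oE' : stub (rprod B C) = o' by apply: val_inj.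
have split_prod (d : inner_dart (rprod A B) C) :
    [\/ exists x : unrooted_dart A, d = inl (a (val x)), d = inl (a (root A)),
    exists y, d = inl (b y) | d = inl o \/ exists z : unrooted_dart C, d = inr z].
  case: d => [[[[x|y]|[]] p]|z] //; last by apply: Or44; right; exists z.
  - have [e|xN] := eqVneq x (root A).
      by apply: Or42; rewrite -e; congr inl; apply: val_inj.
    by apply: Or41; exists (nonroot xN); congr inl; apply: val_inj.
  - by apply: Or43; exists y; congr inl; apply: val_inj.
  - by apply: Or44; left; congr inl; apply: val_inj.
exists F; split.
- by exists G.
- move=> d; case: (split_prod d) => [[x ->]|->|[y ->]|[->|[z ->]]].
  + rewrite (inner_opp_inl _ (x' := a (opp A (val x)))) // Fa.
    have [e|xN] := eqVneq (opp A (val x)) (root A).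
      by rewrite e Fa0 inner_opp_rootl // oE'.
    by rewrite (Fa (nonroot xN)) (inner_opp_inl _ (x' := nonroot xN)).
  + by rewrite (inner_opp_inl _ (x' := a (val (stub A)))) // Fa Fa0 inner_opp_rootr.
  + rewrite (inner_opp_inl _ (x' := b (opp B y))) //.
    by rewrite [RHS](inner_opp_inr _ (y' := b' (opp B y))).
  + rewrite inner_opp_rootl //.
    by rewrite [RHS](inner_opp_inr _ (y' := c' (val (stub C)))).
  + have [e|zN] := eqVneq (opp C (val z)) (root C).
      rewrite (inner_opp_rootr _ e) oE.
      by rewrite [RHS](inner_opp_inr _ (y' := c' (root C))) //= e.
    rewrite (inner_opp_inr _ (y' := nonroot zN)) //.
    by rewrite [RHS](inner_opp_inr _ (y' := c' (opp C (val z)))).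
- move=> d; case: (split_prod d) => [[x ->]|->|[y ->]|[->|[z ->]]].
  + rewrite Fa.
    have -> : nxt (inner (rprod A B) C) (inl (a (val x))) =
        inl (a (val (nonroot (nxt_unrooted x)))).
      by congr inl; apply: val_inj; rewrite /= (negPf (valP x)).
    by rewrite Fa.
  + rewrite Fa0.
    have -> : nxt (inner (rprod A B) C) (inl (a (root A))) = inl (b (root B)).
      by congr inl; apply: val_inj; rewrite /= eqxx.
    by congr inr; apply: val_inj.
  + have [->|yN] := eqVneq y (root B).
      have -> : nxt (inner (rprod A B) C) (inl (b (root B))) = inl o.
        by congr inl; apply: val_inj; rewrite /= eqxx.
      by congr inr; apply: val_inj; rewrite /= eqxx.
    have -> : nxt (inner (rprod A B) C) (inl (b y)) = inl (b (nxt B y)).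
      by congr inl; apply: val_inj; rewrite /= (negPf yN).
    by congr inr; apply: val_inj; rewrite /= (negPf yN).
  + have -> : nxt (inner (rprod A B) C) (inl o) = inl (a (root A)).
      by congr inl; apply: val_inj.
    by rewrite Fa0; congr inr; apply: val_inj; rewrite /= eqxx.
  + by congr inr; apply: val_inj; rewrite /= (negPf (valP z)).
- case=> [[[[x|y]|[]] p]|z] //=; last exact: root_lab.
  case: insubP => [x' _ <-|] //=.
  by rewrite negbK => /eqP ->; rewrite root_lab.
Qed.

Lemma inner_rprod_swap m (A B C : rtree m) :
  iso (inner (rprod A B) C) (inner B (rprod C A)).
Proof.
apply: iso_trans (inner_rprod A B C) _; apply: iso_trans (inner_sym _ _) _.
exact: inner_rprod.
Qed.

(** By induction on the surroundings of the modified place: an outer factor of the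
    triple is moved into K, which is why K is generalized. *)
Lemma inner_ihx m n (I H X : rtree m) : ihx_triple I H X ->
  forall (K : rtree m) (i h x : ugen m n),
    iso (inner I K) i -> iso (inner H K) h -> iso (inner X K) x ->
  quotg_pi (@tree_rel m n) (<< i >> - << h >> + << x >>) = 0.
Proof.
elim=> [A B C|{}I {}H {}X L _ IH|{}I {}H {}X L _ IH
  |{}I {}H {}X I' H' X' _ IH iI iH iX] K i h x Ki Kh Kx.
- exact/quotg_rel/(tree_IHX Ki Kh Kx).
- apply: (IH (rprod L K)); first [exact: iso_trans (iso_sym (inner_rprod _ _ _)) Ki
    | exact: iso_trans (iso_sym (inner_rprod _ _ _)) Kh
    | exact: iso_trans (iso_sym (inner_rprod _ _ _)) Kx].
- apply: (IH (rprod K L)); first [exact: iso_trans (iso_sym (inner_rprod_swap _ _ _)) Ki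
    | exact: iso_trans (iso_sym (inner_rprod_swap _ _ _)) Kh
    | exact: iso_trans (iso_sym (inner_rprod_swap _ _ _)) Kx].
- apply: (IH K); first [exact: iso_trans (inner_isol _ iI) Ki
    | exact: iso_trans (inner_isol _ iH) Kh | exact: iso_trans (inner_isol _ iX) Kx].
Qed.

Section Reversal.
Variable m : nat.

Lemma fconnect_nxt (D : finType) (g : graph m D) : is_tree g ->
  forall v d, fconnect (nxt g) v d = [|| d == v, d == nxt g v | d == nxt g (nxt g v)].
Proof.
move=> gT v d; apply/idP/idP=> [|/or3P[] /eqP->]; last 3 first.
- exact: connect0.
- exact: fconnect1.
- exact: (fconnect_iter _ 2).
move/iter_findex; move: (findex (nxt g) v d) => k; elim: k d => [|k IH] d <- /=.
  by rewrite eqxx.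
case/or3P: (IH _ erefl) => /eqP ->; by rewrite ?eqxx ?orbT ?(nxt3 gT) ?eqxx.
Qed.

Lemma finv_nxt (D : finType) (g : graph m D) : is_tree g ->
  forall d, finv (nxt g) d = nxt g (nxt g d).
Proof.
move=> gT d; have ninj : injective (nxt g) := nxt_inj (nxt3 gT).
by apply: (ninj); rewrite (f_finv ninj) (nxt3 gT).
Qed.

(** At a trivalent vertex the inverse of [nxt] is its square, which is easier to
    transport along isomorphisms than [finv]. *)
Lemma nxt_reverse_at (D : finType) (g : graph m D) v : is_tree g ->
  forall d, nxt (reverse_at g v) d =
    if [|| d == v, d == nxt g v | d == nxt g (nxt g v)]
    then nxt g (nxt g d) else nxt g d.
Proof. by move=> gT d; rewrite /= fconnect_nxt // finv_nxt. Qed.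

Lemma reverse_at_iso (D D' : finType) (g : graph m D) (g' : graph m D') f v :
    is_tree g -> is_tree g' -> bijective f ->
    {morph f : d / opp g d >-> opp g' d} -> {morph f : d / nxt g d >-> nxt g' d} ->
    (forall d, lab g' (f d) = lab g d) ->
  iso (reverse_at g v) (reverse_at g' (f v)).
Proof.
move=> gT gT' fb fo fn fl; have finj := bij_inj fb; exists f; split=> //= d.
rewrite !fconnect_nxt // !finv_nxt // -!fn !(inj_eq finj).
by case: ifP => _; rewrite !fn.
Qed.

Lemma reversal_iso (D1 D2 D1' D2' : finType) (g1 : graph m D1) (g2 : graph m D2)
    (g1' : graph m D1') (g2' : graph m D2') :
  is_tree g1 -> is_tree g1' -> iso g1 g1' -> iso g2 g2' ->
  reversal g1 g2 -> reversal g1' g2'.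
Proof.
move=> gT gT' [f [fb fo fn fl]] i2 [v vN iv]; exists (f v).
  by rewrite (iso_univalent fb fn).
apply: iso_trans (iso_trans iv i2); apply: iso_sym; exact: reverse_at_iso.
Qed.

(** The reversed graph is itself a rooted tree, with the same root, being
    isomorphic to J'; so [inner_isol] reduces the claim to a comparison of two
    graphs on the same half-edges. *)
Lemma inner_reversal (J J' K : rtree m) :
  reversal J J' -> reversal (inner J K) (inner J' K).
Proof.
case=> v vN JJ'.
have univE d : univalent (reverse_at J v) d = univalent J d.
  rewrite /univalent /= (finv_nxt (rtree_tree J)); case: ifP => // _.
  apply/eqP/eqP=> e; last by rewrite !e.
  by rewrite -[RHS](nxt3 (rtree_tree J)) e.
have [f [fb fo fn fl]] := iso_sym JJ'.
have Jv : is_rooted (reverse_at J v) (root J).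
  have := iso_rooted fb fo fn fl (rtreeP J').
  suff fr : f (root J') = root J by rewrite -fr.
  apply/eqP; rewrite -(proj2 (rtreeP J)) -univE (iso_univalent fb fn).
  by rewrite /univalent /= root_univalent eqxx; exact/eqP/(etrans (fl _))/root_lab.
have vr : v != root J by apply: contraNneq vN => ->; rewrite /univalent /= root_univalent.
exists (inl (nonroot vr)); first by rewrite inner_univalent.
apply: iso_trans (inner_isol K (JJ' : iso (RTree Jv) J')).
exists id; split=> //; first by exists id.
- case=> [x|y]; first by [].
  rewrite /=; case: insubP => //= _; congr inl; exact: val_inj.
- move=> d; rewrite [LHS](nxt_reverse_at _ (inner_is_tree J K)).
  case: d => [x|y]; last by [].
  rewrite (_ : [|| _, _ | _] = [|| val x == v, val x == nxt J v
    | val x == nxt J (nxt J v)]) //.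
  transitivity (inl (nonroot (@nxt_unrooted _ (RTree Jv) x)) : inner_dart J K);
    last first.
    by congr inl; apply: val_inj.
  have := nxt_reverse_at v (rtree_tree J) (val x).
  by case: ifP => _ e; congr inl; apply: val_inj; exact: esym e.
Qed.
End Reversal.

(** * Tensor products with Z/2 *)

Section Tens.
Variables A B : zmodType.

Lemma tensDl (a a' : A) (b : B) : tens (a + a') b = tens a b + tens a' b.
Proof.
apply/eqP; rewrite -subr_eq0 opprD addrA; apply/eqP; rewrite /tens -!raddfB.
exact/quotg_rel/tensor_relDl.
Qed.

Lemma tensDr (a : A) (b b' : B) : tens a (b + b') = tens a b + tens a b'.
Proof.
apply/eqP; rewrite -subr_eq0 opprD addrA; apply/eqP; rewrite /tens -!raddfB.
exact/quotg_rel/tensor_relDr.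
Qed.

Lemma tens0l (b : B) : tens (0 : A) b = 0.
Proof. by apply: (addrI (tens 0 b)); rewrite -tensDl !addr0. Qed.

Fact tens_is_zmod_morphism (a : A) : zmod_morphism (@tens A B a).
Proof. by move=> b b'; rewrite -[in RHS](subrK b' b) (tensDr a (b - b')) addrK. Qed.
HB.instance Definition _ a :=
  GRing.isZmodMorphism.Build B (tensor A B) (@tens A B a) (tens_is_zmod_morphism a).

Section TensorLift.
Variables (W : zmodType) (f : A -> B -> W).
Hypothesis fDl : forall a a' b, f (a + a') b = f a b + f a' b.
Hypothesis fDr : forall a b b', f a (b + b') = f a b + f a b'.

Let fpair (ab : (A * B)%type) := f ab.1 ab.2.

Fact tensor_rel_ker w : tensor_rel w -> free_lift fpair w = 0.
Proof.
case=> [a a' b|a b b']; rewrite !raddfB /=.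
  transitivity (f (a + a') b - f a b - f a' b); last by rewrite fDl addrAC addrK subrr.
  by congr (_ - _ - _); exact: free_lift_gen.
transitivity (f a (b + b') - f a b - f a b'); last by rewrite fDr addrAC addrK subrr.
by congr (_ - _ - _); exact: free_lift_gen.
Qed.

Definition tensor_lift : tensor A B -> W := quotg_lift tensor_rel_ker.
HB.instance Definition _ := GRing.Additive.on tensor_lift.

Lemma tensor_lift_tens a b : tensor_lift (tens a b) = f a b.
Proof. by rewrite [LHS]quotg_lift_pi; exact: free_lift_gen. Qed.

End TensorLift.
End Tens.

Section TensorZ2.
Variable L : zmodType.

Lemma Z2_cases (a : 'Z_2) : a = 0 \/ a = 1.
Proof. by case: a => [[|[|//]] p]; [left|right]; apply: val_inj. Qed.

Lemma tens1_mul2 (y : L) : tens (1 : 'Z_2) y *+ 2 = 0.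
Proof. by rewrite mulr2n -tensDl (_ : 1 + 1 = 0) ?tens0l //; apply: val_inj. Qed.

Lemma tensorZ2_surj (c : tensor 'Z_2 L) : exists y : L, tens (1 : 'Z_2) y = c.
Proof.
have [w <-] := quotg_surj c; elim/free_ind: w => [|[a y]|w w' [y ey] [y' ey']].
- by exists 0; rewrite !raddf0.
- have [->|->] := Z2_cases a; last by exists y.
  by exists 0; rewrite raddf0; apply/esym; exact: tens0l.
- by exists (y - y'); rewrite raddfB /= ey ey' -raddfB.
Qed.

Inductive double : L -> Prop := Double z : double (z *+ 2).

Lemma generated_double y : generated double y -> exists z, y = z *+ 2.
Proof.
elim=> [_ [z]|| _ _ _ [z ->] _ [w ->]]; first by exists z.
  by exists 0; rewrite mul0rn.
by exists (z - w); rewrite mulrnBl.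
Qed.

(** The action of Z/2 on L/2L; the induced map on the tensor product sends
    1 (x) y to the class of y and so detects whether y lies in 2L. *)
Definition mod2_act (a : 'Z_2) (y : L) : quotg double := quotg_pi double y *+ (a : nat).

Lemma mod2_actDl a a' y : mod2_act (a + a') y = mod2_act a y + mod2_act a' y.
Proof.
have y2 : quotg_pi double y *+ 2 = 0 by rewrite -raddfMn; exact/quotg_rel/Double.
rewrite /mod2_act -mulrnDr [in RHS](divn_eq (a + a') 2) mulrnDr mulnC mulrnA y2.
by rewrite mul0rn add0r.
Qed.

Lemma mod2_actDr a y y' : mod2_act a (y + y') = mod2_act a y + mod2_act a y'.
Proof. by rewrite /mod2_act raddfD mulrnDl. Qed.

Lemma tens1_eq0 (y : L) : tens (1 : 'Z_2) y = 0 -> exists z, y = z *+ 2.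
Proof.
move=> e; apply/generated_double/quotg_eq0.
have := tensor_lift_tens mod2_actDl mod2_actDr 1 y.
by rewrite e raddf0 => /esym.
Qed.

End TensorZ2.

(** * The form on the Lie group and the exact sequence *)

Section LieForm.
Variables m n : nat.

Lemma tree_class_iso k (t t' : ugen m k) : iso t t' -> tree_class t = tree_class t'.
Proof.
by move=> tt'; apply: subr0_eq; rewrite -raddfB; exact/quotg_rel/tree_iso.
Qed.

(** Generators of [tree_group] are trees on ordinals of a prescribed order, which
    inner products of trees are only up to isomorphism; the default 0 occurs only
    for trees of another order. *)
Definition utree_class k (u : utree m) : tree_group m k :=
  if pselect (exists t : ugen m k, iso u t) is left ut
  then tree_class (projT1 (cid ut)) else 0.

Lemma utree_classE k (u : utree m) (t : ugen m k) :
  iso u t -> utree_class k u = tree_class t.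
Proof.
move=> ut; rewrite /utree_class; case: pselect => [e|[]]; last by exists t.
by case: (cid e) => t' ut' /=; apply: tree_class_iso; apply: iso_trans (iso_sym ut') ut.
Qed.

Lemma inner_ugen (J K : rgen m n) : exists t : ugen m (2 * n), iso (inner J K) t.
Proof.
have e : tree_order (inner J K) = (2 * n)%N.
  by rewrite tree_order_inner /= !rgen_order mul2n addnn.
by rewrite -e; exact: ugen_exists.
Qed.

Definition inner_class (J K : rgen m n) : tree_group m (2 * n) :=
  utree_class (2 * n) (inner J K).

Lemma inner_classC J K : inner_class J K = inner_class K J.
Proof.
have [t Jt] := inner_ugen J K; rewrite /inner_class (utree_classE Jt).
by rewrite (utree_classE (iso_trans (inner_sym K J) Jt)).
Qed.

Lemma inner_form_rel r v : lie_rel r -> free_form inner_classC r v = 0.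
Proof.
move=> rr; elim/free_ind: v => [|K|v w IHv IHw]; first exact: form0r.
  case: rr => [J J' JJ'|J J' JJ'|I H X IHX];
    rewrite ?formDl ?formNl /= !free_form_gen /inner_class.
  - have [t Jt] := inner_ugen J' K; rewrite (utree_classE Jt).
    by rewrite (utree_classE (iso_trans (inner_isol K JJ') Jt)) subrr.
  - have [t Jt] := inner_ugen J K; have [t' Jt'] := inner_ugen J' K.
    rewrite (utree_classE Jt) (utree_classE Jt') -raddfD.
    apply: quotg_rel; apply: tree_AS.
    apply: (reversal_iso (inner_is_tree J K) (proj1 (ugenP t)) Jt Jt').
    exact: inner_reversal.
  - have [i Ii] := inner_ugen I K; have [h Hh] := inner_ugen H K.
    have [x Xx] := inner_ugen X K.
    rewrite (utree_classE Ii) (utree_classE Hh) (utree_classE Xx).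
    by rewrite -(inner_ihx IHX Ii Hh Xx) raddfD raddfB.
by rewrite formC formBl !(formC _ _ r) IHv IHw subrr.
Qed.

Definition lie_form : sym_form (lie_group m n) (tree_group m (2 * n)) :=
  quot_form inner_form_rel.

Lemma lie_formE (J K : rgen m n) (t : ugen m (2 * n)) :
  iso (inner J K) t -> lie_form (lie_class J) (lie_class K) = tree_class t.
Proof.
move=> Jt; rewrite [LHS](quot_form_funE inner_form_rel) [LHS]free_form_gen.
exact: utree_classE.
Qed.

Lemma lie_class_iso (J J' : rgen m n) : iso J J' -> lie_class J = lie_class J'.
Proof.
by move=> tt'; apply: subr0_eq; rewrite -raddfB; exact/quotg_rel/lie_iso.
Qed.

Lemma lie_class_AS (J J' : rgen m n) : reversal J J' -> lie_class J' = - lie_class J.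
Proof.
move=> JJ'; apply/eqP; rewrite -addr_eq0 addrC -raddfD; apply/eqP.
exact/quotg_rel/lie_AS.
Qed.

Lemma lie_class_IHX (I H X : rgen m n) :
  ihx_triple I H X -> lie_class I = lie_class H - lie_class X.
Proof.
move=> IHX; apply: subr0_eq; rewrite opprB addrA addrAC -raddfB -raddfD.
exact/quotg_rel/lie_IHX.
Qed.

Definition twisted_to_ext (v : free_twisted m n) : extension lie_form :=
  ext_incl lie_form v.1 + free_lift (fun J => ext_quad lie_form (lie_class J)) v.2.

Fact twisted_to_ext_is_zmod_morphism : zmod_morphism twisted_to_ext.
Proof. by move=> v w; rewrite /twisted_to_ext !raddfB opprD addrACA. Qed.
HB.instance Definition _ := GRing.isZmodMorphism.Build (free_twisted m n)
  (extension lie_form) twisted_to_ext twisted_to_ext_is_zmod_morphism.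

(** The relation for reversing an orientation yields the relator of [J], since
    q [J] - q (- [J]) is one; the doubling relation is a relator by definition,
    and the IHX relation is one by [ext_quadB]. *)
Lemma twisted_rel_relator v : twisted_rel v ->
  exists y, twisted_to_ext v = ext_relator lie_form y.
Proof.
case=> [J J' JJ'|J J' JJ'|J t Jt|I H X t IHX Ht];
  rewrite /twisted_to_ext /= ?raddfB ?raddfMn /= !free_lift_gen.
- by exists 0; rewrite (lie_class_iso JJ') subrr !raddf0 addr0.
- exists (lie_class J).
  by rewrite (lie_class_AS JJ') ext_quadNE opprB raddf0 add0r addrCA subrr addr0.
- by exists (lie_class J); rewrite -(lie_formE Jt) raddfN addrC.
- exists (- lie_class X); rewrite -(lie_formE Ht) (lie_class_IHX IHX).
  by rewrite ext_quadB raddfN.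
Qed.

Lemma generated_twisted_relator v :
  generated (@twisted_rel m n) v ->
  exists y, twisted_to_ext v = ext_relator lie_form y.
Proof.
elim=> [x /twisted_rel_relator|| x x' _ [y ey] _ [y' ey']] //.
  by exists 0; rewrite !raddf0.
by exists (y - y'); rewrite raddfB /= ey ey' -raddfB.
Qed.

Definition twisted_incl (t : tree_group m (2 * n)) : twisted_group m n :=
  quotg_pi (@twisted_rel m n) (t, 0).

Fact twisted_incl_is_zmod_morphism : zmod_morphism twisted_incl.
Proof.
move=> t s; rewrite /twisted_incl -raddfB.
by congr quotg_pi; congr pair; rewrite /= subr0.
Qed.
HB.instance Definition _ := GRing.isZmodMorphism.Build (tree_group m (2 * n))
  (twisted_group m n) twisted_incl twisted_incl_is_zmod_morphism.

Lemma twisted_incl_inj : injective twisted_incl.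
Proof.
apply: raddf_inj => t /quotg_eq0/generated_twisted_relator[y].
by rewrite /twisted_to_ext /= raddf0 addr0 => /ext_incl_relator.
Qed.

Definition twisted_proj_free (v : free_twisted m n) : tensor 'Z_2 (lie_group m n) :=
  tens 1 (quotg_pi (@lie_rel m n) v.2).

Fact twisted_proj_free_is_zmod_morphism : zmod_morphism twisted_proj_free.
Proof. by move=> v w; rewrite /twisted_proj_free !raddfB. Qed.
HB.instance Definition _ := GRing.isZmodMorphism.Build (free_twisted m n)
  (tensor 'Z_2 (lie_group m n)) twisted_proj_free twisted_proj_free_is_zmod_morphism.

Lemma twisted_proj_rel v : twisted_rel v -> twisted_proj_free v = 0.
Proof.
case=> [J J' JJ'|J J' JJ'|J t Jt|I H X t IHX Ht];
  rewrite /twisted_proj_free /= ?raddfB ?raddfMn /= -?/(lie_class _).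
- by rewrite (lie_class_iso JJ') subrr.
- by rewrite (lie_class_AS JJ') raddfN opprK -mulr2n tens1_mul2.
- exact: tens1_mul2.
- rewrite (lie_class_IHX IHX) raddfB /= (addrAC (tens _ _)) subrr add0r.
  by rewrite -opprD -mulr2n tens1_mul2 oppr0.
Qed.

Definition twisted_proj : twisted_group m n -> tensor 'Z_2 (lie_group m n) :=
  quotg_lift twisted_proj_rel.
HB.instance Definition _ := GRing.Additive.on twisted_proj.

Lemma twisted_proj_pi v :
  twisted_proj (quotg_pi (@twisted_rel m n) v) = tens 1 (quotg_pi (@lie_rel m n) v.2).
Proof. exact: quotg_lift_pi. Qed.

Definition twisted_free (x : {freeg (rgen m n)}) : twisted_group m n :=
  quotg_pi (@twisted_rel m n) (0, x).

Fact twisted_free_is_zmod_morphism : zmod_morphism twisted_free.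
Proof.
move=> x y; rewrite /twisted_free -raddfB.
by congr quotg_pi; congr pair; rewrite /= subr0.
Qed.
HB.instance Definition _ := GRing.isZmodMorphism.Build {freeg (rgen m n)}
  (twisted_group m n) twisted_free twisted_free_is_zmod_morphism.

Lemma twisted_split t x :
  quotg_pi (@twisted_rel m n) (t, x) = twisted_incl t + twisted_free x.
Proof.
rewrite /twisted_incl /twisted_free -raddfD.
by congr quotg_pi; congr pair; rewrite /= ?addr0 ?add0r.
Qed.

(** By the doubling relation: 2 J^oo is the tree <J,J>. *)
Lemma twisted_free_mul2 x : exists t, twisted_incl t = twisted_free x *+ 2.
Proof.
elim/free_ind: x => [|J|x y [t et] [s es]].
- by exists 0; rewrite !raddf0 mul0rn.
- have [t Jt] := inner_ugen J J; exists (tree_class t).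
  apply/esym/subr0_eq; rewrite -raddfMn -[_ - _]addrC -raddfN -twisted_split.
  exact/quotg_rel/twisted_double.
- by exists (t - s); rewrite !raddfB /= et es mulrnBl.
Qed.

(** The relations of the Lie group hold for the symbols J^oo modulo trees: they
    differ from those of the twisted group by twice a symbol. *)
Lemma twisted_free_lie_rel x :
  generated (@lie_rel m n) x -> exists t, twisted_incl t = twisted_free x.
Proof.
elim=> [_ [J J' JJ'|J J' JJ'|I H X IHX]|| {}x y _ [t et] _ [s es]].
- by exists 0; rewrite raddf0; apply/esym/quotg_rel/twisted_iso.
- have [t et] := twisted_free_mul2 << J' >>; exists t; rewrite et.
  rewrite -[in RHS](subrK << J' >> << J >>) -addrA -mulr2n raddfD raddfMn.
  by rewrite [X in _ = X + _](quotg_rel (twisted_sym JJ')) add0r.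
- have [t et] := twisted_free_mul2 << X >>; have [s Hs] := inner_ugen H X.
  exists (t - tree_class s); rewrite raddfB /= et.
  have /eqP := quotg_rel (twisted_IHX IHX Hs).
  rewrite twisted_split addrC addr_eq0 => /eqP <-.
  by rewrite -raddfMn -raddfD /= [X in twisted_free X = _]addrC mulr2n addrA subrK.
- by exists 0; rewrite !raddf0.
- by exists (t - s); rewrite !raddfB /= et es.
Qed.

Lemma twisted_exact (u : twisted_group m n) :
  twisted_proj u = 0 <-> exists t, twisted_incl t = u.
Proof.
split=> [|[t <-]]; last by rewrite twisted_proj_pi !raddf0.
have [[t x] <-] := quotg_surj u; rewrite twisted_proj_pi => /tens1_eq0[z].
have [y <-] := quotg_surj z => /eqP; rewrite -subr_eq0 -raddfMn -raddfB => /eqP.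
move=> /quotg_eq0/twisted_free_lie_rel[s es]; have [r er] := twisted_free_mul2 y.
exists (t + (s + r)); rewrite twisted_split !raddfD /= es er -raddfMn -raddfD.
by rewrite subrK.
Qed.

Lemma twisted_proj_surj c : exists u, twisted_proj u = c.
Proof.
have [y <-] := tensorZ2_surj c; have [x <-] := quotg_surj y.
by exists (twisted_free x); rewrite twisted_proj_pi.
Qed.

End LieForm.

Theorem theorem9 (m n : nat) (hm : (1 <= m)%N) :
  exists (i : {additive tree_group m (2 * n) -> twisted_group m n})
         (p : {additive twisted_group m n -> tensor 'Z_2 (lie_group m n)}),
    [/\ forall t : ugen m (2 * n), i (tree_class t) = twisted_tree t,
        forall t : ugen m (2 * n), p (twisted_tree t) = 0,
        forall J : rgen m n, p (twisted_class J) = tens (1 : 'Z_2) (lie_class J)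
      & short_exact i p].
Proof.
exists (@twisted_incl m n), (@twisted_proj m n); split.
- by [].
- by move=> t; apply/twisted_exact; exists (tree_class t).
- by move=> J; rewrite [LHS]twisted_proj_pi.
- split; [exact: twisted_incl_inj | exact: twisted_exact | exact: twisted_proj_surj].
Qed.
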